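(* Let $A\in\mathbb{R}^{p\times n}$ and $B\in\mathbb{R}^{p\times m}$ satisfy $\operatorname{rge} B\subset \operatorname{rge} A$, and let $$\Omega(A,B)=\left\{(Y,W)\in\mathbb{R}^{n\times m}\times\mathbb{S}^n \;\middle|\; AY=B\ \text{ and }\ \tfrac12 YY^T+W\in\mathcal{K}_A^\circ\right\}.$$ Then the polar set of $\Omega(A,B)$ is $$\Omega(A,B)^\circ=\left\{(X,V)\in\mathbb{R}^{n\times m}\times\mathbb{S}^n\;\middle|\;\operatorname{rge}\begin{pmatrix} X \\ B \end{pmatrix}\subset\operatorname{rge} M(V),\ V\in\mathcal{K}_A,\ \tfrac12\mathrm{tr}\left(\begin{pmatrix} X \\ B \end{pmatrix}^T M(V)^\dagger\begin{pmatrix} X \\ B \end{pmatrix}\right)\le 1\right\}.$$ Moreover, the horizon cones of $\Omega(A,B)$ and of $\Omega(A,B)^\circ$ are $$\Omega(A,B)^\infty=\{0_{n\times m}\}\times\mathcal{K}_A^\circ$$ and $$\left(\Omega(A,B)^\circ\right)^\infty=\left\{(X,V)\in\mathbb{R}^{n\times m}\times\mathbb{S}^n\;\middle|\;\operatorname{rge}\begin{pmatrix} X \\ B \end{pmatrix}\subset\operatorname{rge} M(V),\ V\in\mathcal{K}_A,\ \tfrac12\mathrm{tr}\left(\begin{pmatrix} X \\ B \end{pmatrix}^T M(V)^\dagger\begin{pmatrix} X \\ B \end{pmatrix}\right)\le 0\right\}.$$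
   Context: $\mathbb{S}^n$ is the space of real symmetric $n\times n$ matrices with inner product $\langle V,W\rangle=\mathrm{tr}(VW)$, and $\mathbb{R}^{n\times m}\times\mathbb{S}^n$ carries the inner product $\langle (Y,W),(X,V)\rangle=\mathrm{tr}(Y^TX)+\mathrm{tr}(WV)$. $\operatorname{rge}$ denotes the range (column space). $\mathcal{K}_A:=\{V\in\mathbb{S}^n \mid u^TVu\ge 0\ \text{for all } u\in\ker A\}$ and $\mathcal{K}_A^\circ:=\{W\in\mathbb{S}^n\mid \langle W,V\rangle\le 0\ \text{for all } V\in\mathcal{K}_A\}$ is its polar cone. For $V\in\mathbb{S}^n$, $M(V)=\begin{pmatrix} V & A^T \\ A & 0 \end{pmatrix}$ and $M(V)^\dagger$ is its Moore-Penrose pseudoinverse. The polar set of $S$ is $S^\circ=\{v\mid\langle v,x\rangle\le 1\ \text{for all } x\in S\}$. The horizon cone of $S$ is $S^\infty=\{v\mid \exists\,\lambda_k\downarrow 0,\ x_k\in S:\ \lambda_kx_k\to v\}$; for a nonempty closed convex set $C$ it equals the recession cone $\{v\mid x+tv\in C\ \text{for all } t\ge 0,\ x\in C\}$. With $\sigma_S(x)=\sup_{v\in S}\langle v,x\rangle$ and $\mathcal{D}(A,B)=\{(Y,-\tfrac12YY^T)\mid Y\in\mathbb{R}^{n\times m},\ AY=B\}$, it is known from earlier work that $\sigma_{\mathcal{D}(A,B)}(X,V)=\tfrac12\mathrm{tr}\left(\begin{pmatrix} X \\ B \end{pmatrix}^TM(V)^\dagger\begin{pmatrix} X \\ B \end{pmatrix}\right)$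 if $\operatorname{rge}\begin{pmatrix} X \\ B \end{pmatrix}\subset\operatorname{rge}M(V)$ and $V\in\mathcal{K}_A$, and $\sigma_{\mathcal{D}(A,B)}(X,V)=+\infty$ otherwise. *)

(* Defs.v *)
From HB Require Import structures.
From mathcomp Require Import all_boot all_order all_algebra.
From mathcomp Require Import all_classical all_reals all_analysis.

Set Implicit Arguments.
Unset Strict Implicit.
Unset Printing Implicit Defensive.

Import Order.TTheory GRing.Theory Num.Theory.
Import numFieldNormedType.Exports.

Local Open Scope classical_set_scope.
Local Open Scope ring_scope.

Definition symmx (R : realType) (n : nat) : set 'M[R]_n := [set V | V^T = V].
Arguments symmx : clear implicits.

(* The Euclidean space R^(n x m) x S^n is represented as a subset of
   'M_(n, m) * 'M_n, from which it inherits its vector operations and its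
   topology. *)
Definition mxsym (R : realType) (n m : nat) : set ('M[R]_(n, m) * 'M[R]_n) :=
  [set: 'M[R]_(n, m)] `*` symmx R n.
Arguments mxsym : clear implicits.

Definition innerS (R : realType) (n : nat) (V W : 'M[R]_n) : R := \tr (V *m W).

Definition inner (R : realType) (n m : nat)
    (YW XV : 'M[R]_(n, m) * 'M[R]_n) : R :=
  \tr (YW.1^T *m XV.1) + innerS YW.2 XV.2.

Definition rge (R : realType) (m n : nat) (C : 'M[R]_(m, n)) : set 'cV[R]_m :=
  range (fun u : 'cV[R]_n => C *m u).

Definition KA (R : realType) (p n : nat) (A : 'M[R]_(p, n)) : set 'M[R]_n :=
  [set V | symmx R n V /\
    forall u : 'cV[R]_n, A *m u = 0 -> 0 <= (u^T *m V *m u) 0 0].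

Definition polar_cone (R : realType) (n : nat) (K : set 'M[R]_n) :
    set 'M[R]_n :=
  [set W | symmx R n W /\ forall V, K V -> innerS W V <= 0].

Definition polar (R : realType) (n m : nat)
    (S : set ('M[R]_(n, m) * 'M[R]_n)) : set ('M[R]_(n, m) * 'M[R]_n) :=
  [set v | mxsym R n m v /\ forall x, S x -> inner v x <= 1].

(* The limit is taken in 'M_(n, m) * 'M_n; since S^n is closed, for a subset S
   of R^(n x m) x S^n the result again lies in R^(n x m) x S^n. *)
Definition horizon_cone (R : realType) (n m : nat)
    (S : set ('M[R]_(n, m) * 'M[R]_n)) : set ('M[R]_(n, m) * 'M[R]_n) :=
  [set v | exists (lambda : nat -> R) (x : nat -> 'M[R]_(n, m) * 'M[R]_n),
    [/\ forall k, 0 < lambda k,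
        lambda k @[k --> \oo] --> (0 : R),
        forall k, S (x k) &
        lambda k *: x k @[k --> \oo] --> v]].

Definition is_mpinv (R : realType) (m n : nat)
    (A : 'M[R]_(m, n)) (X : 'M[R]_(n, m)) : Prop :=
  [/\ A *m X *m A = A, X *m A *m X = X,
      (A *m X)^T = A *m X & (X *m A)^T = X *m A].

(* The default 0 is never used, see [mpinvP]. *)
Definition mpinv (R : realType) (m n : nat) (A : 'M[R]_(m, n)) :
    'M[R]_(n, m) :=
  xget 0 [set X | is_mpinv A X].

Lemma trmx_mul_eq0 (R : realType) (m n : nat) (A : 'M[R]_(m, n)) :
  A *m A^T = 0 -> A = 0.
Proof.
move=> AA0; apply/matrixP => i j; rewrite mxE.
have /eqP : \sum_k A i k ^+ 2 = 0.
  transitivity ((A *m A^T) i i); last by rewrite AA0 mxE.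
  by rewrite mxE; apply: eq_bigr => k _; rewrite mxE expr2.
rewrite psumr_eq0 => [/allP/(_ j)|k _]; last exact: sqr_ge0.
by rewrite mem_index_enum sqrf_eq0 => /(_ isT)/eqP.
Qed.

Lemma row_free_gram (R : realType) (m n : nat) (A : 'M[R]_(m, n)) :
  row_free A -> A *m A^T \in unitmx.
Proof.
move=> fA; rewrite -row_free_unit -kermx_eq0; apply/eqP.
set K := kermx _.
have K0 : K *m (A *m A^T) = 0 by exact: mulmx_ker.
have /trmx_mul_eq0 KA0 : (K *m A) *m (K *m A)^T = 0.
  by rewrite trmx_mul !mulmxA -(mulmxA K) K0 mul0mx.
by apply: (row_free_inj fA); rewrite KA0 mul0mx.
Qed.

Lemma is_mpinv_ex (R : realType) (m n : nat) (A : 'M[R]_(m, n)) :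
  exists X, is_mpinv A X.
Proof.
have : row_full (col_base A) by exact: col_base_full.
have : row_free (row_base A) by exact: row_base_free.
move: (col_base A) (row_base A) (mulmx_base A); move: (\rank A)
  => r C F <- fF fC.
have uF : F *m F^T \in unitmx by exact: row_free_gram.
have uC : C^T *m C \in unitmx.
  rewrite -[X in _ *m X]trmxK; apply: row_free_gram.
  by rewrite /row_free mxrank_tr.
pose G := F^T *m invmx (F *m F^T); pose D := invmx (C^T *m C) *m C^T.
have FG : F *m G = 1%:M by rewrite /G mulmxA mulmxV.
have DC : D *m C = 1%:M by rewrite /D -mulmxA mulVmx.
have AX : C *m F *m (G *m D) = C *m D.
  by rewrite mulmxA -(mulmxA C) FG mulmx1.
have XA : G *m D *m (C *m F) = G *m F.
  by rewrite mulmxA -(mulmxA G) DC mulmx1.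
exists (G *m D); split; rewrite ?AX ?XA.
- by rewrite mulmxA -(mulmxA C) DC mulmx1.
- by rewrite mulmxA -(mulmxA G) FG mulmx1.
- by rewrite /D !trmx_mul trmxK trmx_inv trmx_mul trmxK mulmxA.
- by rewrite /G !trmx_mul trmxK trmx_inv trmx_mul trmxK mulmxA.
Qed.

Lemma mpinvP (R : realType) (m n : nat) (A : 'M[R]_(m, n)) :
  is_mpinv A (mpinv A).
Proof. exact: (@xgetPex _ 0 [set X | is_mpinv A X] (is_mpinv_ex A)). Qed.

Lemma is_mpinv_uniq (R : realType) (m n : nat) (A : 'M[R]_(m, n)) X Y :
  is_mpinv A X -> is_mpinv A Y -> X = Y.
Proof.
move=> [AXA XAX AXs XAs] [AYA YAY AYs YAs].
have AXY : A *m X = A *m Y.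
  by rewrite -AXs -[in LHS]AYA -[in LHS]mulmxA trmx_mul AXs AYs mulmxA AXA.
have XYA : X *m A = Y *m A.
  transitivity ((X *m A) *m (Y *m A)); first by rewrite -mulmxA (mulmxA A) AYA.
  by rewrite -[in LHS]XAs -[in LHS]YAs -trmx_mul -mulmxA (mulmxA A) AXA YAs.
by rewrite -XAX -mulmxA AXY mulmxA XYA YAY.
Qed.

Definition Mmx (R : realType) (p n : nat) (A : 'M[R]_(p, n)) (V : 'M[R]_n) :
    'M[R]_(n + p) :=
  block_mx V A^T A 0.

Definition Omega (R : realType) (p n m : nat)
    (A : 'M[R]_(p, n)) (B : 'M[R]_(p, m)) : set ('M[R]_(n, m) * 'M[R]_n) :=
  [set YW | [/\ mxsym R n m YW, A *m YW.1 = B &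
    polar_cone (KA A) (2^-1 *: (YW.1 *m YW.1^T) + YW.2)]].

(* Main.v *)
Require Import Defs.
From HB Require Import structures.
From mathcomp Require Import all_boot all_order all_algebra.
From mathcomp Require Import all_classical all_reals all_analysis.
From mathcomp Require Import lra.

Set Implicit Arguments.
Unset Strict Implicit.
Unset Printing Implicit Defensive.

Import Order.TTheory GRing.Theory Num.Theory.
Import numFieldNormedType.Exports.

Local Open Scope classical_set_scope.
Local Open Scope ring_scope.

(* Maximizing a linear form (X, V) over [Omega A B] amounts to maximizing
   f(Y) = tr(Y^T X) - tr(Y^T V Y)/2 over the affine set AY = B. Bounded values
   force V to be nonnegative on ker A (test with W - t u u^T) and (X; B) to be
   orthogonal to ker M(V) (test with Y + t Z, AZ = 0), so that M(V)(C; L) =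
   (X; B) is solvable; then C maximizes f by concavity, and f(C) is the
   pseudoinverse quadratic form.
   A point of the horizon cone of a set S is nonpositive against every form
   bounded above on S. With the forms (V C + A^T L, V), where V is in K_A and
   AC = B, this gives the horizon cone of [Omega A B]; it also identifies the
   horizon cone of the polar set with the forms that are <= 0 on [Omega A B],
   i.e. the polar description with 1 replaced by 0. *)

(** * Traces, ranges and kernels *)

Lemma mxtrace_mul_symC (R : realType) (n m : nat) (V : 'M[R]_n)
    (C Y : 'M[R]_(n, m)) :
  V^T = V -> \tr (C^T *m V *m Y) = \tr (Y^T *m V *m C).
Proof. by move=> Vs; rewrite -mxtrace_tr !trmx_mul trmxK Vs mulmxA. Qed.

Lemma mxtrace_gram_le0 (R : realType) (n m : nat) (Y : 'M[R]_(n, m)) :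
  \tr (Y^T *m Y) <= 0 -> Y = 0.
Proof.
move=> le0; apply/matrixP => i j; rewrite mxE; apply/eqP.
have ge0 k : 0 <= \sum_l Y l k ^+ 2 by apply: sumr_ge0 => l _; exact: sqr_ge0.
have trE : \tr (Y^T *m Y) = \sum_k \sum_l Y l k ^+ 2.
  by apply: eq_bigr => k _; rewrite mxE; apply: eq_bigr => l _;
     rewrite mxE expr2.
have /eqP : \sum_k \sum_l Y l k ^+ 2 = 0.
  by apply/eqP; rewrite eq_le -trE le0 trE sumr_ge0.
rewrite psumr_eq0// => /allP/(_ j); rewrite mem_index_enum => /(_ isT)/= {trE}.
rewrite psumr_eq0 => [/allP/(_ i)|l _]; last exact: sqr_ge0.
by rewrite mem_index_enum sqrf_eq0; apply.
Qed.

Lemma rge_sub_mulP (R : realType) (k l m : nat) (N : 'M[R]_(k, m))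
    (M : 'M[R]_(k, l)) :
  rge N `<=` rge M <-> exists D, N = M *m D.
Proof.
split=> [NM|[D ->] _ [u _ <-]]; last by exists (D *m u) => //; rewrite mulmxA.
have ex j : exists d, M *m d = col j N.
  have [|d _ <-] := NM (col j N); last by exists d.
  by exists (delta_mx j 0) => //; rewrite colE.
exists (\matrix_(i, j) projT1 (cid (ex j)) i 0); apply/matrixP => i j.
have := projT2 (cid (ex j)) => /(congr1 (fun v : 'cV_k => v i 0)).
by rewrite [RHS]mxE => <-; rewrite !mxE; apply: eq_bigr => r _; rewrite mxE.
Qed.

(** The range of a symmetric matrix is the orthogonal complement of its kernel. *)
Lemma rge_sub_ker (R : realType) (k m : nat) (N : 'M[R]_(k, m)) (M : 'M[R]_k) :
  M^T = M -> (forall z : 'cV_k, M *m z = 0 -> z^T *m N = 0) ->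
  rge N `<=` rge M.
Proof.
move=> Ms kerN; apply/rge_sub_mulP.
have /submxP[D ND] : (N^T <= M)%MS.
  (* Row-space inclusion means [N^T *m cokermx M = 0]; by symmetry of [M], each column of
     [cokermx M] is a [z] to which [kerN] applies. *)
  rewrite submxE; apply/eqP/trmx_inj/row_matrixP => i.
  rewrite -tr_col trmx0 row0 colE -mulmxA -colE trmx_mul trmxK kerN// colE.
  by rewrite mulmxA mulmx_coker mul0mx.
by exists D^T; rewrite -[LHS]trmxK ND trmx_mul Ms.
Qed.

(** * The matrix M(V) and its pseudoinverse form *)

Lemma Mmx_sym (R : realType) (p n : nat) (A : 'M[R]_(p, n)) (V : 'M[R]_n) :
  V^T = V -> (Mmx A V)^T = Mmx A V.
Proof. by move=> Vs; rewrite /Mmx tr_block_mx Vs trmxK trmx0. Qed.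

Lemma mul_Mmx_col (R : realType) (p n m : nat) (A : 'M[R]_(p, n))
    (V : 'M[R]_n) (C : 'M[R]_(n, m)) (L : 'M[R]_(p, m)) :
  Mmx A V *m col_mx C L = col_mx (V *m C + A^T *m L) (A *m C).
Proof. by rewrite /Mmx mul_block_col mul0mx addr0. Qed.

(** The identity M M^+ M = M removes the pseudoinverse and leaves the quadratic form of M(V) at (C;
    L), whose two off-diagonal blocks contribute equally. *)
Lemma mpinv_form (R : realType) (p n m : nat) (A : 'M[R]_(p, n)) (V : 'M[R]_n)
    (C : 'M[R]_(n, m)) (L : 'M[R]_(p, m)) :
  V^T = V ->
  2^-1 * \tr ((col_mx (V *m C + A^T *m L) (A *m C))^T *m mpinv (Mmx A V)
              *m col_mx (V *m C + A^T *m L) (A *m C)) =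
  2^-1 * \tr (C^T *m V *m C) + \tr (L^T *m (A *m C)).
Proof.
move=> Vs; have [MXM _ _ _] := mpinvP (Mmx A V).
rewrite -mul_Mmx_col trmx_mul (Mmx_sym _ Vs) -!mulmxA.
rewrite (mulmxA (mpinv _)) (mulmxA (Mmx A V)) (mulmxA (Mmx A V)) MXM.
rewrite mul_Mmx_col tr_col_mx mul_row_col mulmxDr !mxtraceD.
rewrite -[\tr (C^T *m (A^T *m L))]mxtrace_tr !trmx_mul !trmxK !mulmxA.
by lra.
Qed.

(** * Linear forms bounded above on [Omega A B] *)

Lemma mxtrace_KA_ge0 (R : realType) (p n m : nat) (A : 'M[R]_(p, n))
    (V : 'M[R]_n) (Z : 'M[R]_(n, m)) :
  KA A V -> A *m Z = 0 -> 0 <= \tr (Z^T *m V *m Z).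
Proof.
move=> [_ Vge0] AZ0; apply: sumr_ge0 => j _.
have := Vge0 (col j Z); rewrite colE mulmxA AZ0 mul0mx -colE => /(_ erefl).
by rewrite tr_col -row_mul !mxE; under eq_bigr do rewrite !mxE;
   under [X in _ -> _ <= X]eq_bigr do rewrite !mxE.
Qed.

Lemma polar_coneZ (R : realType) (n : nat) (K : set 'M[R]_n) (a : R)
    (S : 'M[R]_n) :
  0 <= a -> polar_cone K S -> polar_cone K (a *: S).
Proof.
move=> a0 [Ss SK]; split; first by rewrite /symmx/= linearZ/= Ss.
by move=> V /SK; rewrite /innerS -scalemxAl mxtraceZ; exact: mulr_ge0_le0.
Qed.

Lemma polar_cone_opp_dyad (R : realType) (p n : nat) (A : 'M[R]_(p, n))
    (u : 'cV[R]_n) :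
  A *m u = 0 -> polar_cone (KA A) (- (u *m u^T)).
Proof.
move=> Au; split; first by rewrite /symmx/= linearN/= trmx_mul trmxK.
move=> V [_ /(_ u Au)]; rewrite /innerS mulNmx raddfN/= oppr_le0.
by rewrite -(mulmxA u) mxtrace_mulC trace_mx11.
Qed.

(** With Z = Y - C, the gap between the two sides is tr(Z^T V Z)/2 - <YY^T/2 + W, V>. The first term
    is nonnegative since AZ = 0, and the pairing is nonpositive by polarity. *)
Lemma inner_Omega_le (R : realType) (p n m : nat) (A : 'M[R]_(p, n))
    (V : 'M[R]_n) (C : 'M[R]_(n, m)) (L : 'M[R]_(p, m)) x :
  KA A V -> Omega A (A *m C) x ->
  inner (V *m C + A^T *m L, V) x <=
  2^-1 * \tr (C^T *m V *m C) + \tr (L^T *m (A *m C)).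
Proof.
case: x => Y W KV [/= _ AY [_ /(_ _ KV)]]; have [Vs _] := KV.
rewrite /inner /innerS/= linearD/= mulmxDl mxtraceD !trmx_mul trmxK Vs.
rewrite mulmxDl mxtraceD -scalemxAl mxtraceZ -AY.
rewrite (mxtrace_mulC W) -[Y *m Y^T *m V]mulmxA (mxtrace_mulC Y).
have AZ0 : A *m (Y - C) = 0 by rewrite mulmxBr AY subrr.
have := mxtrace_KA_ge0 KV AZ0.
rewrite [(Y - C)^T]linearB/= !(mulmxBl, mulmxBr) !raddfB/= !mulmxA.
by rewrite (@mxtrace_mul_symC _ _ _ V C Y Vs) //; lra.
Qed.

Lemma inner_le_OmegaP (R : realType) (p n m : nat) (A : 'M[R]_(p, n))
    (B : 'M[R]_(p, m)) (rgeBA : rge B `<=` rge A) (c : R) (X : 'M[R]_(n, m))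
    (V : 'M[R]_n) :
  V^T = V ->
  (forall x, Omega A B x -> inner (X, V) x <= c) <->
  [/\ rge (col_mx X B) `<=` rge (Mmx A V), KA A V &
      2^-1 * \tr ((col_mx X B)^T *m mpinv (Mmx A V) *m col_mx X B) <= c].
Proof.
move=> Vs; split; last first.
  move=> [/rge_sub_mulP[D]]; rewrite -[D]vsubmxK mul_Mmx_col.
  move=> /eq_col_mx[-> ->] KV; rewrite mpinv_form// => le x Ox.
  exact: le_trans (inner_Omega_le _ KV Ox) le.
move=> le.
(* Points of [Omega A B] are parametrized by [Y] and [S] through W = S - YY^T/2. *)
have leY Y S : A *m Y = B -> polar_cone (KA A) S ->
    \tr (X^T *m Y) - 2^-1 * \tr (Y^T *m V *m Y) + \tr (V *m S) <= c.
  move=> AY KS; have := le (Y, S - 2^-1 *: (Y *m Y^T)).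
  rewrite /inner /innerS /= mulmxBr raddfB/= -scalemxAr mxtraceZ.
  rewrite (mulmxA V) (mxtrace_mulC (V *m Y)) (mulmxA Y^T).
  rewrite -addrA (addrC (- _)); apply; split=> //=; last by rewrite addrC subrK.
  split=> //=; rewrite /symmx/= linearB/= linearZ/= trmx_mul trmxK.
  by case: KS => ->.
have [Y0 BE] := (rge_sub_mulP B A).1 rgeBA.
have slope_le0 (a b : R) : (forall t : R, 0 <= t -> a + t * b <= c) -> b <= 0.
  move=> ab; rewrite leNgt; apply/negP => b0.
  (* At this [t] the affine function equals a + |c - a| + 1, which exceeds c. *)
  have t0 : 0 <= (`|c - a| + 1) / b.
    by apply: divr_ge0 (ltW b0); rewrite addr_ge0.
  have := ab _ t0; rewrite divfK ?gt_eqF//.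
  by have := ler_norm (c - a); lra.
have KV : KA A V.
  split=> // u Au; rewrite -oppr_le0.
  (* Along S = - t u u^T with Y = Y0 fixed, the slope is - u^T V u. *)
  apply: (slope_le0 (\tr (X^T *m Y0) - 2^-1 * \tr (Y0^T *m V *m Y0))) => t t0.
  have := leY Y0 _ (esym BE) (polar_coneZ t0 (polar_cone_opp_dyad Au)).
  rewrite -scalemxAr mxtraceZ mulmxN raddfN/= (mulmxA V).
  by rewrite (mxtrace_mulC (V *m u)) mulmxA trace_mx11.
have K0 : polar_cone (KA A) 0.
  split; first by rewrite /symmx/= trmx0.
  by move=> ? _; rewrite /innerS mul0mx mxtrace0.
have solv : rge (col_mx X B) `<=` rge (Mmx A V).
  apply: rge_sub_ker (Mmx_sym _ Vs) _ => z.
  rewrite -[z]vsubmxK; move: (usubmx z) (dsubmx z) => u l.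
  rewrite mul_Mmx_col -col_mx0 => /eq_col_mx[/eqP]; rewrite addr_eq0.
  move=> /eqP Vu Au.
  (* Here w = z^T (X; B). Moving Y0 in the direction Z = u w keeps AY = B and kills the quadratic
     term, as V u = - A^T l and A u = 0; the slope is then tr(w^T w), which forces w = 0. *)
  rewrite tr_col_mx mul_row_col; move w_def: (_ + _) => w.
  apply: mxtrace_gram_le0.
  apply: (slope_le0 (\tr (X^T *m Y0) - 2^-1 * \tr (Y0^T *m V *m Y0))) => t _.
  have AY : A *m (Y0 + t *: (u *m w)) = B.
    by rewrite mulmxDr -scalemxAr mulmxA Au mul0mx scaler0 addr0.
  have VZ : V *m (u *m w) = - (A^T *m l *m w) by rewrite mulmxA Vu mulNmx.
  have ZVZ : (u *m w)^T *m V *m (u *m w) = 0.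
    rewrite -mulmxA VZ mulmxN !mulmxA -trmx_mul mulmxA Au mul0mx trmx0.
    by rewrite !mul0mx oppr0.
  have YVZ : \tr (Y0^T *m V *m (u *m w)) = - \tr (B^T *m l *m w).
    by rewrite -mulmxA VZ mulmxN raddfN/= !mulmxA -trmx_mul -BE.
  have -> : \tr (w^T *m w) = \tr (X^T *m (u *m w)) + \tr (B^T *m l *m w).
    by rewrite -{1}w_def [(_ + _)^T]linearD/= !trmx_mul !trmxK
      mulmxDl mxtraceD mulmxA.
  have := leY _ _ AY K0; rewrite mulmx0 mxtrace0 addr0.
  rewrite [(Y0 + _)^T]linearD/= [(t *: _)^T]linearZ/=.
  rewrite !(mulmxDl, mulmxDr) -!(scalemxAl, scalemxAr).
  rewrite !(mxtraceD, mxtraceZ) ZVZ mxtrace0 YVZ.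
  by rewrite (mxtrace_mul_symC (u *m w) Y0 Vs) YVZ; lra.
split=> //; move: solv => /rge_sub_mulP[D]; rewrite -[D]vsubmxK mul_Mmx_col.
move: (usubmx D) (dsubmx D) => C L /eq_col_mx[XE CE].
(* At Y = C and S = 0 the linear form takes exactly the value of the pseudoinverse form. *)
have := leY C 0 (esym CE) K0; rewrite mulmx0 mxtrace0 addr0 XE CE mpinv_form//.
rewrite [(_ + _)^T]linearD/= !trmx_mul trmxK Vs mulmxDl mxtraceD !mulmxA.
by lra.
Qed.

(** * Horizon cones *)

Lemma inner_cvg (R : realType) (n m : nat) (v : 'M[R]_(n, m) * 'M[R]_n)
    (x : nat -> 'M[R]_(n, m) * 'M[R]_n) y :
  x k @[k --> \oo] --> v -> inner y (x k) @[k --> \oo] --> inner y v.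
Proof.
move=> xv.
have x1 : (x k).1 @[k --> \oo] --> v.1 by exact: (cvg_comp _ _ xv cvg_fst).
have x2 : (x k).2 @[k --> \oo] --> v.2 by exact: (cvg_comp _ _ xv cvg_snd).
have entry k l (N : nat -> 'M[R]_(k, l)) (N0 : 'M[R]_(k, l)) i j :
    N r @[r --> \oo] --> N0 -> N r i j @[r --> \oo] --> N0 i j.
  by move=> NN0; apply: cvg_comp NN0 (@coord_continuous _ _ _ _ _ _).
have tr_cvg k l (P : 'M[R]_(k, l)) (N : nat -> 'M[R]_(l, k))
    (N0 : 'M[R]_(l, k)) :
    N r @[r --> \oo] --> N0 -> \tr (P *m N r) @[r --> \oo] --> \tr (P *m N0).
  move=> NN0; apply: (cvg_big add_continuous) => i _.
  rewrite mxE; under eq_fun do rewrite mxE.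
  apply: (cvg_big add_continuous) => j _; apply: cvgMl_tmp; exact: entry.
by apply: cvgD; exact: tr_cvg.
Qed.

Lemma innerZr (R : realType) (n m : nat) (a : R)
    (x y : 'M[R]_(n, m) * 'M[R]_n) :
  inner y (a *: x) = a * inner y x.
Proof. by rewrite /inner /innerS/= -!scalemxAr !mxtraceZ mulrDr. Qed.

Lemma innerC (R : realType) (n m : nat) (x y : 'M[R]_(n, m) * 'M[R]_n) :
  inner x y = inner y x.
Proof.
by rewrite /inner /innerS mxtrace_mulC -mxtrace_tr trmx_mul trmxK
  mxtrace_mulC [X in _ + X]mxtrace_mulC.
Qed.

(** The bound on [lambda k *: x k] is [lambda k * c], which tends to 0. *)
Lemma horizon_cone_barrier (R : realType) (n m : nat)
    (S : set ('M[R]_(n, m) * 'M[R]_n)) v y (c : R) :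
  horizon_cone S v -> (forall x, S x -> inner y x <= c) -> inner y v <= 0.
Proof.
move=> [lam [x [lam0 lamc Sx xv]]] le.
have lamc0 : lam k * c @[k --> \oo] --> 0.
  by rewrite -(mul0r c); exact: cvgMr_tmp.
apply: ler_cvg_to (inner_cvg (y := y) xv) lamc0 _.
by apply: nearW => k; rewrite innerZr ler_wpM2l ?le// ltW.
Qed.

Lemma horizon_cone_mxsym (R : realType) (n m : nat)
    (S : set ('M[R]_(n, m) * 'M[R]_n)) v :
  S `<=` mxsym R n m -> horizon_cone S v -> v.2^T = v.2.
Proof.
move=> Ssym Sv.
(* Symmetric matrices are orthogonal to the skew part of [v.2]. *)
have skew_le0 : inner (0, v.2^T - v.2) v <= 0.
  apply: (horizon_cone_barrier (c := 0) Sv) => x /Ssym[_ xs].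
  rewrite /inner /innerS/= trmx0 mul0mx mxtrace0 add0r mulmxBl raddfB/=.
  by rewrite -[\tr (v.2^T *m _)]mxtrace_tr trmx_mul trmxK xs mxtrace_mulC subrr.
(* The Gram trace of [v.2^T - v.2] is twice the pairing just bounded. *)
apply/eqP; rewrite -subr_eq0; apply/eqP/mxtrace_gram_le0; move: skew_le0.
rewrite /inner /innerS/= trmx0 mul0mx mxtrace0 add0r [(_ - _)^T]linearB/= trmxK.
have trVV : \tr (v.2^T *m v.2^T) = \tr (v.2 *m v.2).
  by rewrite -trmx_mul mxtrace_tr.
rewrite !(mulmxBl, mulmxBr) !raddfB/= (mxtrace_mulC v.2 v.2^T) trVV.
by lra.
Qed.

Lemma polar_horizon_coneE (R : realType) (n m : nat)
    (S : set ('M[R]_(n, m) * 'M[R]_n)) :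
  horizon_cone (polar S) =
  [set v | mxsym R n m v /\ forall x, S x -> inner v x <= 0].
Proof.
apply/seteqP; split=> [v Sv|v [vs le0]].
  split; first by split=> //; apply: horizon_cone_mxsym Sv => x [].
  move=> x Sx; rewrite innerC; apply: (horizon_cone_barrier (c := 1) Sv).
  by move=> y [_ /(_ _ Sx)]; rewrite innerC.
(* Every nonnegative multiple of [v] stays in the polar set, and [harmonic k] is the inverse of k +
   1, so the rescaled sequence is constantly [v]. *)
exists harmonic, (fun k => k.+1%:R *: v); split.
- by move=> k; rewrite /harmonic/= invr_gt0 ltr0n.
- exact: cvg_harmonic.
- move=> k; split=> [|x Sx].
    split=> //=; by case: vs => _; rewrite /symmx/= linearZ/= => ->.
  rewrite innerC innerZr innerC (le_trans _ ler01)//.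
  by rewrite mulr_ge0_le0// le0.
- under eq_fun do rewrite scalerA /harmonic/= mulVf ?pnatr_eq0// scale1r.
  exact: cvg_cst.
Qed.

Lemma Omega_horizon_coneE (R : realType) (p n m : nat)
    (A : 'M[R]_(p, n)) (B : 'M[R]_(p, m)) :
  rge B `<=` rge A ->
  horizon_cone (Omega A B) = [set 0] `*` polar_cone (KA A).
Proof.
move=> /rge_sub_mulP[C ->]; apply/seteqP; split=> [[Y W] Ov|[_ S] [/= -> KS]].
  have Ws : W^T = W by apply: horizon_cone_mxsym Ov => x [].
  have le0 V D L : KA A V -> A *m D = A *m C ->
      inner (V *m D + A^T *m L, V) (Y, W) <= 0.
    move=> KV AD; apply: horizon_cone_barrier Ov _ => x.
    by rewrite -AD; exact: inner_Omega_le.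
  have KA0 : KA A 0.
    by split=> [|u _]; rewrite /symmx/= ?trmx0// mulmx0 mul0mx mxE.
  have KA1 : KA A 1%:M.
    split=> [|u _]; rewrite /symmx/= ?trmx1// mulmx1 mxE.
    by apply: sumr_ge0 => i _; rewrite mxE -expr2 sqr_ge0.
  have AY0 : A *m Y = 0.
    (* The choice V = 0, L = AY turns the form into the squared norm of AY. *)
    apply: mxtrace_gram_le0; have := le0 0 C (A *m Y) KA0 erefl.
    rewrite mul0mx add0r /inner /innerS/= mul0mx mxtrace0 addr0.
    by rewrite trmx_mul trmxK !mulmxA.
  have Y0 : Y = 0.
    apply: mxtrace_gram_le0; rewrite leNgt; apply/negP => Y_gt0.
    (* With V = I and D = C + tY, this [t] makes the form equal to 1 at (Y, W), against the bound
       0. *)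
    pose t := (1 - \tr (C^T *m Y) - \tr W) / \tr (Y^T *m Y).
    have AD : A *m (C + t *: Y) = A *m C.
      by rewrite mulmxDr -scalemxAr AY0 scaler0 addr0.
    have := le0 _ _ 0 KA1 AD; rewrite mulmx0 addr0 mul1mx /inner /innerS/=.
    rewrite mul1mx linearD linearZ/= mulmxDl -scalemxAl mxtraceD mxtraceZ.
    by rewrite /t divfK ?gt_eqF//; lra.
  split=> //=; split=> // V KV; have := le0 V C 0 KV erefl.
  rewrite mulmx0 addr0 Y0 /inner /innerS/= mulmx0 mxtrace0 add0r.
  by rewrite mxtrace_mulC.
(* The first component is fixed at a solution of AY = B and the correction - CC^T/2 is constant, so
   both vanish after rescaling and only [S] survives. *)
exists harmonic, (fun k => (C, k.+1%:R *: S - 2^-1 *: (C *m C^T))); split.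
- by move=> k; rewrite /harmonic/= invr_gt0 ltr0n.
- exact: cvg_harmonic.
- move=> k; have := polar_coneZ (ler0n R k.+1) KS => kS; split=> //=.
    split=> //=; rewrite /symmx/= linearB/= !linearZ/= trmx_mul trmxK.
    by case: KS => ->.
  by rewrite addrC subrK.
- have cvg0 k l (N : 'M[R]_(k, l)) :
      harmonic r *: N @[r --> \oo] --> (0 : 'M[R]_(k, l)).
    by rewrite -(scale0r N); apply: cvgZr_tmp; exact: cvg_harmonic.
  have cvgS :
      harmonic k *: (k.+1%:R *: S - 2^-1 *: (C *m C^T)) @[k --> \oo] --> S.
    rewrite -[X in _ --> X]subr0.
    under eq_fun do
      rewrite scalerBr scalerA /harmonic/= mulVf ?pnatr_eq0// scale1r.
    by apply: cvgB; [exact: cvg_cst | exact: cvg0].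
  exact: cvg_pair (cvg0 _ _ C) cvgS.
Qed.

Theorem proposition4p6 (R : realType) (p n m : nat)
    (A : 'M[R]_(p, n)) (B : 'M[R]_(p, m)) (rgeBA : rge B `<=` rge A) :
  [/\ polar (Omega A B) =
        [set XV | [/\ mxsym R n m XV,
                      rge (col_mx XV.1 B) `<=` rge (Mmx A XV.2),
                      KA A XV.2 &
                      2^-1 * \tr ((col_mx XV.1 B)^T *m mpinv (Mmx A XV.2)
                                    *m col_mx XV.1 B) <= 1]],
      horizon_cone (Omega A B) = [set 0] `*` polar_cone (KA A) &
      horizon_cone (polar (Omega A B)) =
        [set XV | [/\ mxsym R n m XV,
                      rge (col_mx XV.1 B) `<=` rge (Mmx A XV.2),
                      KA A XV.2 &
                      2^-1 * \tr ((col_mx XV.1 B)^T *m mpinv (Mmx A XV.2)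
                                    *m col_mx XV.1 B) <= 0]]].
Proof.
(* The level [c] is kept general: c = 1 gives the polar set and c = 0 its horizon cone. *)
have le_OmegaE c : [set v | mxsym R n m v /\
    forall x, Omega A B x -> inner v x <= c] =
    [set XV | [/\ mxsym R n m XV,
      rge (col_mx XV.1 B) `<=` rge (Mmx A XV.2), KA A XV.2 &
      2^-1 * \tr ((col_mx XV.1 B)^T *m mpinv (Mmx A XV.2)
                    *m col_mx XV.1 B) <= c]].
  apply/seteqP; split=> [[X V] [[_ Vs]]|[X V] [/= [_ Vs] rgeM KV le]].
    by move=> /(inner_le_OmegaP rgeBA c X Vs)[].
  by split=> //; apply/(inner_le_OmegaP rgeBA c X Vs).
split; [exact: le_OmegaE | exact: Omega_horizon_coneE |].
by rewrite polar_horizon_coneE le_OmegaE.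
Qed.
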